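(* Let $\mathcal{C}$ be any subrecursive class that is closed under primitive recursive operations. Then there exist irrational numbers $\alpha,\beta\in(0,1)$ such that $$(i)\;\; \alpha\in\mathcal{C}_{g\downarrow}\setminus\mathcal{C}_{g\uparrow}\qquad\text{and}\qquad (ii)\;\;\beta\in\mathcal{C}_{g\uparrow}\setminus\mathcal{C}_{g\downarrow}.$$
   Context: All real numbers considered lie strictly between $0$ and $1$. A base is a natural number $b\geq 2$. Every irrational $\alpha\in(0,1)$ can be written uniquely as $\alpha=\sum_{i=1}^\infty \mathtt{D}_i b^{-k_i}$ with $\mathtt{D}_i\in\{1,\dots,b-1\}$ and $0<k_1<k_2<\cdots$. Set $\hat{A}^\alpha_b(0)=0$, $\hat{A}^\alpha_b(i)=\mathtt{D}_ib^{-k_i}$ for $i>0$, and $\check{A}^\alpha_b=\hat{A}^{1-\alpha}_b$. The general sum approximation from below of $\alpha$ is $\hat{G}^\alpha(b,n)=\hat{A}^\alpha_b(n)$ for $b\ge2$ and $\hat{G}^\alpha(b,n)=0$ for $b<2$; the general sum approximation from above is $\check{G}^\alpha(b,n)=\check{A}^\alpha_b(n)$ for $b\ge 2$ and $0$ for $b<2$. Rationals are coded into $\mathbb{N}$ in a standard elementary way. A subrecursive class is an efficiently enumerable class of computable total functions; it is closed under primitive recursive operations if it contains all primitive recursive functions and every function primitive recursive in functions of the class is in the class. $\mathcal{C}_{g\uparrow}$ (resp. $\mathcal{C}_{g\downarrow}$) denotes the set of irrational numbers whose general sum approximation from below (resp. above) belongs to $\mathcal{C}$. *)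

(* Defs.v *)
From mathcomp Require Import all_boot all_order all_algebra.
From mathcomp Require Import all_classical all_reals all_analysis.

Set Implicit Arguments.
Unset Strict Implicit.
Unset Printing Implicit Defensive.

Import Order.TTheory GRing.Theory Num.Theory.
Import numFieldNormedType.Exports.

Local Open Scope classical_set_scope.
Local Open Scope ring_scope.

Definition natfun (n : nat) := n.-tuple nat -> nat.

(* A class of number-theoretic functions of arbitrary arities. *)
Definition fun_class := forall n : nat, natfun n -> Prop.

Definition zero_fun (n : nat) : natfun n := fun _ => 0%N.

Definition succ_fun : natfun 1 := fun x => (thead x).+1.

Definition proj_fun (n : nat) (i : 'I_n) : natfun n := fun x => tnth x i.

Definition comp_fun (m n : nat) (g : natfun m) (h : 'I_m -> natfun n) :
    natfun n :=
  fun x => g [tuple h i x | i < m].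

(* f (0, x) = g x and f (y + 1, x) = h (y, f (y, x), x) *)
Definition rec_fun (n : nat) (g : natfun n) (h : natfun n.+2) : natfun n.+1 :=
  fun x => nat_rect (fun _ => nat) (g [tuple of behead x])
    (fun y r => h [tuple of y :: r :: behead x]) (thead x).

(* Functions primitive recursive in functions of the class F. *)
Inductive primrec_in (F : fun_class) : forall n : nat, natfun n -> Prop :=
| PR_given n (f : natfun n) : F n f -> primrec_in F f
| PR_zero n : primrec_in F (@zero_fun n)
| PR_succ : primrec_in F succ_fun
| PR_proj n (i : 'I_n) : primrec_in F (proj_fun i)
| PR_comp m n (g : natfun m) (h : 'I_m -> natfun n) :
    primrec_in F g -> (forall i, primrec_in F (h i)) ->
    primrec_in F (comp_fun g h)
| PR_rec n (g : natfun n) (h : natfun n.+2) :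
    primrec_in F g -> primrec_in F h -> primrec_in F (rec_fun g h).

Definition primrec (n : nat) (f : natfun n) : Prop :=
  primrec_in (fun _ _ => False) f.

(* Computable total functions, as Kleene's general recursive functions;
   minimization is only applied when it yields a total function f. *)
Inductive computable : forall n : nat, natfun n -> Prop :=
| Comp_zero n : computable (@zero_fun n)
| Comp_succ : computable succ_fun
| Comp_proj n (i : 'I_n) : computable (proj_fun i)
| Comp_comp m n (g : natfun m) (h : 'I_m -> natfun n) :
    computable g -> (forall i, computable (h i)) -> computable (comp_fun g h)
| Comp_rec n (g : natfun n) (h : natfun n.+2) :
    computable g -> computable h -> computable (rec_fun g h)
| Comp_mu n (g : natfun n.+1) (f : natfun n) :
    computable g ->
    (forall x, g [tuple of f x :: x] = 0%N) ->
    (forall x y, (y < f x)%N -> g [tuple of y :: x] <> 0%N) ->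
    computable f.

Definition fun1 (f : nat -> nat) : natfun 1 := fun x => f (thead x).

Definition fun2 (f : nat -> nat -> nat) : natfun 2 :=
  fun x => f (tnth x ord0) (tnth x ord_max).

(* C = {f_0, f_1, f_2, ...} where the arity ar e of f_e and the value
   f_e (x_1, ..., x_n) = U e <x_1, ..., x_n> are computable uniformly in e;
   CodeSeq.code is an elementary bijection from finite sequences to nat. *)
Definition efficiently_enumerable (C : fun_class) : Prop :=
  exists (ar : nat -> nat) (U : nat -> nat -> nat),
    [/\ computable (fun1 ar), computable (fun2 U) &
        forall (n : nat) (f : natfun n),
          C n f <-> exists e : nat,
            ar e = n /\ forall x : n.-tuple nat, f x = U e (CodeSeq.code x)].

Definition subrecursive_class (C : fun_class) : Prop :=
  (forall (n : nat) (f : natfun n), C n f -> computable f) /\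
  efficiently_enumerable C.

Definition closed_under_primrec (C : fun_class) : Prop :=
  (forall (n : nat) (f : natfun n), primrec f -> C n f) /\
  (forall (n : nat) (f : natfun n), primrec_in C f -> C n f).

Definition int_code (z : int) : nat :=
  match z with Posz n => n.*2 | Negz n => n.*2.+1 end.

Definition rat_code (q : rat) : nat :=
  CodeSeq.code [:: int_code (numq q); int_code (denq q)].

Lemma int_code_inj : injective int_code.
Proof.
move=> [m|m] [n|n] //= e.
- by rewrite -(doubleK m) e doubleK.
- by have := congr1 odd e; rewrite /= !odd_double.
- by have := congr1 odd e; rewrite /= !odd_double.
- by case: e => e; rewrite -(doubleK m) e doubleK.
Qed.

Lemma rat_code_inj : injective rat_code.
Proof.
move=> p q /(can_inj CodeSeq.codeK) [] /int_code_inj en /int_code_inj ed.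
by rewrite -(divq_num_den p) en ed divq_num_den.
Qed.

(* Only the values of D and k at positive indices are relevant. *)
Definition base_expansion (R : realType) (b : nat) (alpha : R)
    (D k : nat -> nat) : Prop :=
  [/\ forall i, (0 < i)%N -> (0 < D i < b)%N,
      (0 < k 1)%N,
      forall i, (0 < i)%N -> (k i < k i.+1)%N &
      (fun n : nat => \sum_(1 <= i < n.+1) (D i)%:R * (b%:R : R) ^- k i) @ \oo
        --> alpha].

Definition is_sum_approx (R : realType) (b : nat) (alpha : R)
    (A : nat -> rat) : Prop :=
  exists D k : nat -> nat,
    [/\ base_expansion b alpha D k, A 0%N = 0 &
        forall i, (0 < i)%N -> A i = (D i)%:R * (b%:R : rat) ^- k i].

(* For b >= 2 and alpha irrational in (0,1) there is exactly one A with
   is_sum_approx b alpha A; otherwise the value is not meaningful. *)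
Definition sum_approx_below (R : realType) (b : nat) (alpha : R) : nat -> rat :=
  xget (fun _ => 0) [set A | is_sum_approx b alpha A].

Definition sum_approx_above (R : realType) (b : nat) (alpha : R) : nat -> rat :=
  sum_approx_below b (1 - alpha).

Definition gen_sum_below (R : realType) (alpha : R) (b n : nat) : rat :=
  if (2 <= b)%N then sum_approx_below b alpha n else 0.

Definition gen_sum_above (R : realType) (alpha : R) (b n : nat) : rat :=
  if (2 <= b)%N then sum_approx_above b alpha n else 0.

Definition irr01 (R : realType) : set R :=
  [set alpha : R | 0 < alpha < 1 /\ irrational alpha].

Definition class_gup (R : realType) (C : fun_class) : set R :=
  [set alpha : R | irr01 alpha /\
     C 2 (fun2 (fun b n => rat_code (gen_sum_below alpha b n)))].

Definition class_gdown (R : realType) (C : fun_class) : set R :=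
  [set alpha : R | irr01 alpha /\
     C 2 (fun2 (fun b n => rat_code (gen_sum_above alpha b n)))].

(* Main.v *)
Require Import Defs.
From mathcomp Require Import all_boot all_order all_algebra.
From mathcomp Require Import all_classical all_reals all_analysis.
From mathcomp Require Import zify ring lra.

Set Implicit Arguments.
Unset Strict Implicit.
Unset Printing Implicit Defensive.

Import Order.TTheory GRing.Theory Num.Theory.
Import numFieldNormedType.Exports.

(** Let x be the sum of 2 ^ - 4 ^ t over the t in a set E of naturals. The gaps
    between the exponents are so wide that floor (x * b ^ p) is computed by the
    terms t <= b * p alone, and 1 - x exceeds its base b truncation at p by at
    least a primitive recursive amount. Hence, whenever E is primitive
    recursive, so is the enumeration of the nonzero digits of 1 - x in all bases
    simultaneously. In base 2 the nonzero digits of x itself sit at positions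
    4 ^ t, so the sum approximation of x from below is outside C as soon as the
    increasing enumeration of E escapes all unary functions of C. Such a
    primitive recursive E is obtained by running a staged computation of the
    diagonal U i <i> and putting t into E when the current i is seen to converge
    at stage t to a value below t; then i is incremented. The two numbers of the
    theorem are x and 1 - x. *)

(** * Primitive recursive functions *)

Lemma primrec_ext F n (f g : natfun n) :
  f =1 g -> primrec_in F g -> primrec_in F f.
Proof. by move=> /funext ->. Qed.

Definition primrec_tuple F m n (w : m.-tuple nat -> n.-tuple nat) : Prop :=
  forall i, primrec_in F (fun x => tnth (w x) i).

Lemma primrec_subst F m n (g : natfun n) (w : m.-tuple nat -> n.-tuple nat) :
  primrec_in F g -> primrec_tuple F w -> primrec_in F (fun x => g (w x)).
Proof.
move=> hg hw; apply: primrec_ext (PR_comp hg hw) => x; congr g.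
by apply/eq_from_tnth => i; rewrite tnth_mktuple.
Qed.

Lemma primrec_tuple_id F n : primrec_tuple F (@id (n.-tuple nat)).
Proof. by move=> i; apply: PR_proj. Qed.

Lemma primrec_tuple_cons F m n (u : natfun m) (w : m.-tuple nat -> n.-tuple nat) :
  primrec_in F u -> primrec_tuple F w ->
  primrec_tuple F (fun x => [tuple of u x :: w x]).
Proof.
move=> hu hw i; case: (unliftP ord0 i) => [j ->|->].
  by apply: primrec_ext (hw j) => x; rewrite tnthS.
by apply: primrec_ext hu => x; rewrite tnth0.
Qed.

Lemma primrec_tuple_behead F m n (w : m.-tuple nat -> n.+1.-tuple nat) :
  primrec_tuple F w ->
  primrec_tuple F (fun x => [tuple of behead (w x)] : n.-tuple nat).
Proof.
move=> hw i; apply: primrec_ext (hw (lift ord0 i)) => x.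
by rewrite [in RHS](tuple_eta (w x)) tnthS.
Qed.

Lemma primrec_tuple_mktuple F m n (h : 'I_n -> natfun m) :
  (forall i, primrec_in F (h i)) ->
  primrec_tuple F (fun x => [tuple h i x | i < n]).
Proof.
by move=> hh i; apply: primrec_ext (hh i) => x; rewrite tnth_mktuple.
Qed.

Lemma primrec_thead F m n (w : m.-tuple nat -> n.+1.-tuple nat) :
  primrec_tuple F w -> primrec_in F (fun x => thead (w x)).
Proof. by move=> hw; exact: hw ord0. Qed.

Lemma primrec_const F n c : primrec_in F (fun _ : n.-tuple nat => c).
Proof.
elim: c => [|c IHc]; first exact: PR_zero.
apply: primrec_ext (PR_comp (h := fun _ => _) (PR_succ F) (fun _ => IHc)) => x.
by rewrite /comp_fun /succ_fun /thead tnth_mktuple.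
Qed.

Lemma primrec_succ F n (u : natfun n) :
  primrec_in F u -> primrec_in F (fun x => (u x).+1).
Proof.
move=> hu; apply: primrec_ext (PR_comp (h := fun _ => _) (PR_succ F) (fun _ => hu)) => x.
by rewrite /comp_fun /succ_fun /thead tnth_mktuple.
Qed.

(** [PR_rec] evaluated at the tuple [m x :: x]. The recursion depth may depend on the parameters and
    the step is curried, which is the shape in which [nat_rect] occurs below. *)
Lemma primrec_rec F n (m g : natfun n) (h : nat -> nat -> natfun n) :
  primrec_in F m -> primrec_in F g ->
  primrec_in F (fun z : n.+2.-tuple nat =>
    h (thead z) (thead [tuple of behead z])
      [tuple of behead [tuple of behead z]]) ->
  primrec_in F (fun x =>
    nat_rect (fun _ => nat) (g x) (fun y r => h y r x) (m x)).
Proof.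
move=> hm hg hh.
have hw : primrec_tuple F (fun x => [tuple of m x :: x]).
  by apply: primrec_tuple_cons => //; exact: primrec_tuple_id.
apply: primrec_ext (primrec_subst (PR_rec hg hh) hw) => x.
rewrite /rec_fun theadE; congr (nat_rect _ _ _ _).
  by congr g; apply: val_inj.
apply/funext => y; apply/funext => r.
by congr h; rewrite /thead ?(tnth_nth 0) //; apply: val_inj.
Qed.

(* In the step function of [primrec_rec] the parameters x sit behind the counter
   and the previous value. *)
Lemma primrec_wk2 F n (u : natfun n) : primrec_in F u ->
  primrec_in F (fun z : n.+2.-tuple nat =>
    u [tuple of behead [tuple of behead z]]).
Proof.
move=> hu; apply: (primrec_subst hu).
apply: (primrec_tuple_behead (w := fun z : n.+2.-tuple nat => [tuple of behead z])).
apply: (primrec_tuple_behead (w := id)).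
exact: primrec_tuple_id.
Qed.

Lemma primrec_wk2_0 F n :
  primrec_in F (fun z : n.+2.-tuple nat => thead z).
Proof. exact: (primrec_thead (w := id) (@primrec_tuple_id F _)). Qed.

Lemma primrec_wk2_1 F n :
  primrec_in F (fun z : n.+2.-tuple nat => thead [tuple of behead z]).
Proof.
apply: (primrec_thead (w := fun z : n.+2.-tuple nat => [tuple of behead z])).
exact: (primrec_tuple_behead (w := id) (@primrec_tuple_id F _)).
Qed.

Create HintDb pr.
Ltac solve_primrec := solve [eauto 30 with pr].
#[local] Hint Resolve primrec_const primrec_succ
  primrec_wk2 primrec_wk2_0 primrec_wk2_1 : pr.

(** * Arithmetic functions, Boolean tests and bounded search *)

Lemma primrec_pred F n (u : natfun n) :
  primrec_in F u -> primrec_in F (fun x => (u x).-1).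
Proof.
move=> hu; pose h := fun (y r : nat) (x : n.-tuple nat) => y.
apply: (primrec_ext (g := fun x => nat_rect (fun _ => nat) 0 (fun y r => h y r x) (u x))).
  by move=> x; case: (u x).
apply: primrec_rec; rewrite /h; solve_primrec.
Qed.
#[local] Hint Resolve primrec_pred : pr.

Lemma primrec_add F n (u v : natfun n) : primrec_in F u -> primrec_in F v ->
  primrec_in F (fun x => u x + v x).
Proof.
move=> hu hv; pose h := fun (y r : nat) (x : n.-tuple nat) => r.+1.
apply: (primrec_ext (g := fun x => nat_rect (fun _ => nat) (v x) (fun y r => h y r x) (u x))).
  by move=> x; elim: (u x) => //= y <-.
apply: primrec_rec; rewrite /h; solve_primrec.
Qed.
#[local] Hint Resolve primrec_add : pr.

Lemma primrec_sub F n (u v : natfun n) : primrec_in F u -> primrec_in F v ->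
  primrec_in F (fun x => u x - v x).
Proof.
move=> hu hv; pose h := fun (y r : nat) (x : n.-tuple nat) => r.-1.
apply: (primrec_ext (g := fun x => nat_rect (fun _ => nat) (u x) (fun y r => h y r x) (v x))).
  by move=> x; elim: (v x) => [|y] /=; rewrite ?subn0 // subnS => ->.
apply: primrec_rec; rewrite /h; solve_primrec.
Qed.
#[local] Hint Resolve primrec_sub : pr.

Lemma primrec_mul F n (u v : natfun n) : primrec_in F u -> primrec_in F v ->
  primrec_in F (fun x => u x * v x).
Proof.
move=> hu hv; pose h := fun (y r : nat) (x : n.-tuple nat) => v x + r.
apply: (primrec_ext (g := fun x => nat_rect (fun _ => nat) 0 (fun y r => h y r x) (u x))).
  by move=> x; elim: (u x) => //= y <-; rewrite mulSn.
apply: primrec_rec; rewrite /h; solve_primrec.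
Qed.
#[local] Hint Resolve primrec_mul : pr.

Lemma primrec_exp F n (u v : natfun n) : primrec_in F u -> primrec_in F v ->
  primrec_in F (fun x => u x ^ v x).
Proof.
move=> hu hv; pose h := fun (y r : nat) (x : n.-tuple nat) => u x * r.
apply: (primrec_ext (g := fun x => nat_rect (fun _ => nat) 1 (fun y r => h y r x) (v x))).
  by move=> x; elim: (v x) => //= y <-; rewrite expnS.
apply: primrec_rec; rewrite /h; solve_primrec.
Qed.
#[local] Hint Resolve primrec_exp : pr.

Lemma primrec_eq0 F n (u : natfun n) :
  primrec_in F u -> primrec_in F (fun x => u x == 0 : nat).
Proof.
move=> hu; apply: (primrec_ext (g := fun x => 1 - u x)); last by solve_primrec.
by move=> x; case: (u x).
Qed.

Lemma primrec_leq F n (u v : natfun n) : primrec_in F u -> primrec_in F v ->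
  primrec_in F (fun x => u x <= v x : nat).
Proof. by move=> hu hv; apply: primrec_eq0; solve_primrec. Qed.

Lemma primrec_neg F n (P : n.-tuple nat -> bool) :
  primrec_in F (fun x => P x : nat) -> primrec_in F (fun x => ~~ P x : nat).
Proof.
move=> hP; apply: (primrec_ext (g := fun x => 1 - P x)).
  by move=> x; case: (P x).
exact: primrec_sub (primrec_const _ _ _) hP.
Qed.

Lemma primrec_and F n (P Q : n.-tuple nat -> bool) :
  primrec_in F (fun x => P x : nat) -> primrec_in F (fun x => Q x : nat) ->
  primrec_in F (fun x => P x && Q x : nat).
Proof.
move=> hP hQ; apply: primrec_ext (primrec_mul hP hQ) => x.
by rewrite mulnb.
Qed.

Lemma primrec_eq F n (u v : natfun n) : primrec_in F u -> primrec_in F v ->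
  primrec_in F (fun x => u x == v x : nat).
Proof.
move=> hu hv.
have h := primrec_and (primrec_leq hu hv) (primrec_leq hv hu).
by apply: primrec_ext h => x; rewrite eqn_leq.
Qed.

Lemma primrec_if F n (P : n.-tuple nat -> bool) (u v : natfun n) :
  primrec_in F (fun x => P x : nat) -> primrec_in F u -> primrec_in F v ->
  primrec_in F (fun x => if P x then u x else v x).
Proof.
move=> hP hu hv.
apply: primrec_ext (primrec_add (primrec_mul hP hu)
         (primrec_mul (primrec_neg hP) hv)) => x.
by case: (P x); rewrite /= ?mul1n ?mul0n ?addn0.
Qed.
#[local] Hint Resolve primrec_eq0 primrec_leq primrec_neg primrec_and
  primrec_eq primrec_if : pr.

(** The least [r < B] with [P r], and [B] if there is none: the recursion state is the current
    candidate, which freezes once it satisfies [P]. *)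
Definition bounded_search (P : nat -> bool) (B : nat) : nat :=
  nat_rect (fun _ => nat) 0 (fun _ r => if P r then r else r.+1) B.

Lemma bounded_searchP (P : nat -> bool) (B j : nat) : P j -> j <= B ->
  P (bounded_search P B) /\ forall i, i < bounded_search P B -> ~~ P i.
Proof.
move=> Pj leB.
have H c : let s := bounded_search P c in
    (forall i, i < s -> ~~ P i) /\ (P s \/ s = c).
  elim: c => [|c [IH1 IH2]] /=; first by split=> //; right.
  have [Ps|nPs] := boolP (P (bounded_search P c)); first by split; [|left].
  case: IH2 => [Ps|e]; first by rewrite Ps in nPs.
  split; last by right; rewrite e.
  move=> i; rewrite ltnS leq_eqVlt => /orP[/eqP->//|]; exact: IH1.
have [H1 H2] := H B; split=> //.
case: H2 => // e; have [lt|] := ltnP j B; first by have:= H1 j; rewrite e Pj => /(_ lt).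
by move=> ge; rewrite e (_ : B = j) //; apply/eqP; rewrite eqn_leq ge leB.
Qed.

Lemma primrec_search F n (P : nat -> n.-tuple nat -> bool) (B : natfun n) :
  primrec_in F (fun z : n.+2.-tuple nat =>
    P (thead [tuple of behead z]) [tuple of behead [tuple of behead z]] : nat) ->
  primrec_in F B ->
  primrec_in F (fun x => bounded_search (P^~ x) (B x)).
Proof.
move=> hP hB; pose h := fun (y r : nat) (x : n.-tuple nat) => if P r x then r else r.+1.
apply: (primrec_rec (h := h)); rewrite /h; solve_primrec.
Qed.

Lemma primrec_div F n (u v : natfun n) : primrec_in F u -> primrec_in F v ->
  primrec_in F (fun x => u x %/ v x).
Proof.
move=> hu hv.
(* A disjunction written with negation and conjunction, the connectives already covered. Its first
   disjunct accounts for the convention that division by 0 gives 0. *)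
pose P' (q : nat) (x : n.-tuple nat) :=
  ~~ (~~ ((v x == 0) && (q == 0)) && ~~ (u x < q.+1 * v x)).
apply: (primrec_ext (g := fun x => bounded_search (P'^~ x) (u x))).
  move=> x; have [H1 H2] : P' (u x %/ v x) x /\ u x %/ v x <= u x.
    rewrite leq_div /P' negb_and !negbK; split=> //.
    have [->|v0] := posnP (v x); first by rewrite divn0.
    by rewrite ltn_ceil // orbT.
  have [] := @bounded_searchP (P'^~ x) (u x) _ H1 H2.
  set s := bounded_search _ _ => H3 H4.
  apply/eqP; rewrite eqn_leq; apply/andP; split; last first.
    by rewrite leqNgt; apply/negP => /H4; rewrite H1.
  move: H3; rewrite /P' negb_and !negbK => /orP[/andP[/eqP -> _]|].
    by rewrite divn0.
  have [->|v0] := posnP (v x); first by rewrite muln0.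
  by rewrite -ltn_divLR.
apply: primrec_search; rewrite // /P'; solve_primrec.
Qed.
#[local] Hint Resolve primrec_div : pr.

(** The search ascends in [d], so the candidate divisor [u + v - d] descends and the first hit is
    the greatest common divisor. Divisibility is tested by multiplying the quotient back. *)
Lemma primrec_gcd F n (u v : natfun n) : primrec_in F u -> primrec_in F v ->
  primrec_in F (fun x => gcdn (u x) (v x)).
Proof.
move=> hu hv.
pose P' (d : nat) (x : n.-tuple nat) :=
 (u x %/ (u x + v x - d) * (u x + v x - d) == u x) &&
 (v x %/ (u x + v x - d) * (u x + v x - d) == v x).
have P'E d x : P' d x = (u x + v x - d %| gcdn (u x) (v x)).
  by rewrite /P' dvdn_gcd !dvdn_eq.
apply: (primrec_ext (g := fun x => u x + v x - bounded_search (P'^~ x) (u x + v x))).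
  move=> x; set g := gcdn _ _; have leg : g <= u x + v x.
    have [u0|u0] := posnP (u x); first by rewrite /g u0 gcd0n leq_addl.
    by rewrite (leq_trans (dvdn_leq u0 (dvdn_gcdl _ _))) ?leq_addr.
  have H1 : P' (u x + v x - g) x by rewrite P'E subKn.
  have [] := @bounded_searchP (P'^~ x) (u x + v x) _ H1 (leq_subr _ _).
  set s := bounded_search _ _ => H3 H4.
  apply/eqP; rewrite eqn_leq; apply/andP; split.
    have : s <= u x + v x - g.
      by rewrite leqNgt; apply/negP => /H4; rewrite H1.
    lia.
  have [g0|g0] := posnP g; last by move: H3; rewrite P'E => /dvdn_leq; apply.
  have [u0 v0] : u x = 0 /\ v x = 0.
    by split; apply/eqP; rewrite -dvd0n -g0 ?dvdn_gcdl ?dvdn_gcdr.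
  by rewrite u0 v0.
apply: primrec_sub; first by solve_primrec.
apply: primrec_search; rewrite // /P'; solve_primrec.
Qed.

(** * Staged computation of computable functions *)

Lemma primrec_prod F n m (h : 'I_m -> natfun n) :
  (forall i, primrec_in F (h i)) ->
  primrec_in F (fun x => \prod_(i < m) h i x).
Proof.
elim: m h => [|m IHm] h hh.
  by apply: (primrec_ext (g := fun=> 1)) => [x|]; [rewrite big_ord0 | solve_primrec].
apply: (primrec_ext (g := fun x => h ord0 x * \prod_(i < m) h (lift ord0 i) x)).
  by move=> x; rewrite big_ord_recl.
by apply: primrec_mul => //; apply: (IHm (fun i => h (lift ord0 i))) => i.
Qed.

Definition primrec_staged F n (G : nat -> natfun n) : Prop :=
  primrec_in F (fun z : n.+1.-tuple nat => G (thead z) [tuple of behead z]).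

Lemma primrec_staged_app F m n (G : nat -> natfun n) (u : natfun m)
    (w : m.-tuple nat -> n.-tuple nat) :
  primrec_staged F G -> primrec_in F u -> primrec_tuple F w ->
  primrec_in F (fun z => G (u z) (w z)).
Proof.
move=> hG hu hw.
apply: primrec_ext (primrec_subst hG (primrec_tuple_cons hu hw)) => z.
by rewrite theadE; congr G; apply: val_inj.
Qed.

(** [0] encodes that no value is known at stage [t], and [v.+1] encodes the value [v]. An announced
    value is never wrong, and from some stage on it is always announced. *)
Definition stage_approx n (f : natfun n) (G : nat -> natfun n) : Prop :=
  [/\ forall t x, G t x = 0 \/ G t x = (f x).+1 &
      forall x, exists t0, forall t, t0 <= t -> G t x = (f x).+1].

Lemma stage_approx_const n (f : natfun n) :
  stage_approx f (fun _ x => (f x).+1).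
Proof. by split=> [t x|x]; [right | exists 0]. Qed.

(** The product is nonzero exactly when all inner values are known; predecessors then decode them.
    Since there are finitely many inner functions, the maximum of their convergence stages
    exists. *)
Lemma stage_approx_comp m n (g : natfun m) (h : 'I_m -> natfun n) G H :
  stage_approx g G -> (forall i, stage_approx (h i) (H i)) ->
  stage_approx (comp_fun g h)
    (fun t x => if \prod_(i < m) H i t x == 0 then 0
                else G t [tuple (H i t x).-1 | i < m]).
Proof.
move=> [G1 G2] hH.
have HE t x : (forall i, H i t x != 0) ->
    [tuple (H i t x).-1 | i < m] = [tuple h i x | i < m].
  move=> h0; apply: eq_from_tnth => i; rewrite !tnth_mktuple.
  by case: (hH i) => + _ => /(_ t x) [|->] // e; have := h0 i; rewrite e.
split=> [t x|x].
  case: eqP => [_|p0]; first by left.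
  rewrite HE; first exact: G1.
  by move=> i; apply/eqP => e; apply: p0; rewrite (bigD1 i) //= e.
have [T hT] := choice (fun i => proj2 (hH i) x).
have [t0 ht0] := G2 [tuple h i x | i < m].
exists (maxn t0 (\max_(i < m) T i)) => t; rewrite geq_max => /andP[le0 leT].
have Ht i : H i t x = (h i x).+1.
  by apply: hT; apply: leq_trans leT; apply: leq_bigmax_cond.
have h0 i : 0 < H i t x by rewrite Ht.
rewrite ifN; last by rewrite -lt0n prodn_gt0.
by rewrite HE ?ht0 // => i; rewrite -lt0n.
Qed.

(** A missing intermediate value propagates as [0]. Convergence follows by induction on the
    recursion argument, each unfolding adding one more stage to the maximum. *)
Lemma stage_approx_rec n (g : natfun n) (h : natfun n.+2) G H :
  stage_approx g G -> stage_approx h H ->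
  stage_approx (rec_fun g h) (fun t x =>
    nat_rect (fun _ => nat) (G t [tuple of behead x])
      (fun y r => if r == 0 then 0 else
                  H t [tuple of y :: r.-1 :: behead x]) (thead x)).
Proof.
move=> [G1 G2] [H1 H2]; split=> [t x|x]; rewrite /rec_fun.
  set f1 := fun y r : nat => if _ then _ else _; set f2 := fun y r : nat => h _.
  elim: (thead x) => [|y IH]; first exact: G1.
  rewrite [X in X = 0 \/ X = _]/= [X in _ \/ _ = X.+1]/=.
  by case: IH => ->; [left | exact: H1].
set f2 := fun y r : nat => h _.
elim: (thead x) => [|y [t0 IH]]; first exact: G2.
have [t1 ht1] := H2 [tuple of y :: nat_rect (fun _ => nat) (g [tuple of behead x])
    f2 y :: behead x].
exists (maxn t0 t1) => t; rewrite geq_max => /andP[l0 l1].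
pose f1 y r := if r == 0 then 0 else H t [tuple of y :: r.-1 :: behead x].
have {}IH : nat_rect (fun _ => nat) (G t [tuple of behead x]) f1 y = _ := IH t l0.
apply: etrans (ht1 t l1).
change (f1 y (nat_rect (fun _ => nat) (G t [tuple of behead x]) f1 y) =
  H t [tuple of
    y :: nat_rect (fun _ => nat) (g [tuple of behead x]) f2 y :: behead x]).
by rewrite IH.
Qed.

(* Search state: 0 means stuck, 1 still searching, v.+2 found v. *)
Definition mu_step n (G : nat -> natfun n.+1) t (x : n.-tuple nat) y r :=
  if r == 1 then
    if G t [tuple of y :: x] == 0 then 0
    else if G t [tuple of y :: x] == 1 then y.+2 else 1
  else r.

(** At stage [t] the candidates below [t] are tested in order. The search gets stuck at an undecided
    candidate, since skipping it could lead to a zero that is not the least. The final predecessor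
    sends both stuck and searching to [0], and [v.+2] to the code [v.+1] of [v]. *)
Lemma stage_approx_mu n (g : natfun n.+1) (f : natfun n) G :
  (forall x, g [tuple of f x :: x] = 0%N) ->
  (forall x y, (y < f x)%N -> g [tuple of y :: x] <> 0%N) ->
  stage_approx g G ->
  stage_approx f (fun t x => (nat_rect (fun _ => nat) 1 (mu_step G t x) t).-1).
Proof.
move=> gf gmin [G1 G2].
have fE (x : n.-tuple nat) y : g [tuple of y :: x] = 0 -> y <= f x -> y = f x.
  move=> g0; rewrite leq_eqVlt => /orP[/eqP//|/gmin]; by rewrite g0.
have inv t (x : n.-tuple nat) c : let s := nat_rect (fun _ => nat) 1 (mu_step G t x) c in
    [\/ s = 0, s = 1 /\ c <= f x | s = (f x).+2].
  elim: c => [|c]; first by apply: Or32.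
  move=> /= [->|[-> lec]|->]; [by apply: Or31| | by apply: Or33].
  rewrite /mu_step /=; case: (G1 t [tuple of c :: x]) => -> /=; first exact: Or31.
  case: eqP => [[] e|ne]; first by apply: Or33; rewrite (fE _ _ e lec).
  apply: Or32; split=> //; rewrite ltn_neqAle lec andbT; apply/eqP => e.
  by apply: ne; rewrite e gf.
split=> [t x|x].
  by case: (inv t x t) => [|[]|] ->; [left|left|right].
have [T hT] := choice (fun y => G2 [tuple of y :: x]).
pose t0 := \max_(y < (f x).+1) T y.
have ht0 t y : t0 <= t -> y <= f x -> G t [tuple of y :: x] = (g [tuple of y :: x]).+1.
  move=> le0 ley; apply: hT; apply: leq_trans le0.
  have ley' : y < (f x).+1 by rewrite ltnS.
  exact: (leq_bigmax_cond (F := fun y : 'I_(f x).+1 => T y) (Ordinal ley')).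
(* Late enough for [g] to be decided at every candidate up to [f x], and for the search to get past
   [f x]. *)
exists (maxn t0 (f x).+1) => t; rewrite geq_max => /andP[le0 lef].
have searching c : c <= f x -> nat_rect (fun _ => nat) 1 (mu_step G t x) c = 1.
  elim: c => //= c IH lec; rewrite IH; last exact: ltnW.
  rewrite /mu_step /= ht0 //; last exact: ltnW.
  by rewrite /=; case: eqP => //= -[] e; have := gmin _ _ lec.
have found d : nat_rect (fun _ => nat) 1 (mu_step G t x) (d + (f x).+1) = (f x).+2.
  elim: d => [|d IH]; last by rewrite addSn /= IH.
  by rewrite add0n /= searching // /mu_step /= ht0 // gf.
by rewrite -[X in nat_rect _ _ _ X](subnK lef) found.
Qed.

(** A substitute for Kleene's normal form, by induction on the derivation of [computable f]. Stages
    turn the unbounded search into a bounded one. *)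
Lemma computable_staged F n (f : natfun n) : computable f ->
  exists2 G, primrec_staged F G & stage_approx f G.
Proof.
elim=> {n f} [n||n i|m n g h _ [G hG aG] _ IH|n g h _ [G hG aG] _ [H hH aH]
             |n g f _ [G hG aG] gf gmin].
- exists (fun _ x => (@zero_fun n x).+1); last exact: stage_approx_const.
  by rewrite /primrec_staged /zero_fun; solve_primrec.
- exists (fun _ x => (succ_fun x).+1); last exact: stage_approx_const.
  rewrite /primrec_staged /succ_fun; do 2! apply: primrec_succ.
  exact: primrec_wk2_1.
- exists (fun _ x => (proj_fun i x).+1); last exact: stage_approx_const.
  rewrite /primrec_staged /proj_fun; apply: primrec_succ.
  exact: (primrec_tuple_behead (w := id) (@primrec_tuple_id F _)).
- have [H hH] := choice (fun i => let: ex_intro2 G h1 h2 := IH i in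
    ex_intro (fun G => primrec_staged F G /\ stage_approx (h i) G) G (conj h1 h2)).
  eexists; last first.
    by apply: (stage_approx_comp aG) => i; case: (hH i) => _; apply.
  apply: primrec_if; [|solve_primrec|].
    apply: primrec_eq0.
    apply: (primrec_prod (h := fun i (z : n.+1.-tuple nat) =>
      H i (thead z) [tuple of behead z])) => i.
    by case: (hH i).
  apply: (primrec_staged_app hG).
    exact: (primrec_thead (w := id) (@primrec_tuple_id F _)).
  apply: (primrec_tuple_mktuple (h := fun i (z : n.+1.-tuple nat) =>
    (H i (thead z) [tuple of behead z]).-1)) => i.
  by apply: primrec_pred; case: (hH i).
- eexists; last exact: stage_approx_rec aG aH.
  (* The stage stands before the recursion argument, so the whole tuple [z] is kept as the parameter
     of the recursion. *)
  pose gg (z : n.+2.-tuple nat) := G (thead z) [tuple of behead [tuple of behead z]].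
  pose hh (y r : nat) (z : n.+2.-tuple nat) := if r == 0 then 0 else
    H (thead z) [tuple of y :: [tuple of r.-1 :: [tuple of behead [tuple of behead z]]]].
  have hb k : primrec_tuple F (fun z : k.+2.-tuple nat =>
      [tuple of behead [tuple of behead z]] : k.-tuple nat).
    apply: (primrec_tuple_behead (w := fun z : k.+2.-tuple nat => [tuple of behead z])).
    apply: (primrec_tuple_behead (w := id)); exact: primrec_tuple_id.
  apply: (primrec_ext (g := fun z => nat_rect (fun _ => nat) (gg z)
            (fun y r => hh y r z) (thead [tuple of behead z]))).
    by move=> z; congr (nat_rect _ _ _ _).
  apply: primrec_rec; first exact: primrec_wk2_1.
    by apply: (primrec_staged_app hG); [exact: primrec_wk2_0 | exact: hb].
  apply: primrec_if; [solve_primrec|solve_primrec|].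
  apply: (primrec_staged_app hH).
    by apply: (primrec_wk2 (u := fun x => thead x)); exact: primrec_wk2_0.
  apply: primrec_tuple_cons; first exact: primrec_wk2_0.
  apply: primrec_tuple_cons; first by apply: primrec_pred; exact: primrec_wk2_1.
  by move=> i; exact: (primrec_wk2 (hb n i)).
- eexists; last exact: stage_approx_mu gf gmin aG.
  rewrite /primrec_staged; apply: primrec_pred.
  have h0 : primrec_in F (fun z : n.+1.-tuple nat => thead z).
    exact: (primrec_thead (w := id) (@primrec_tuple_id F _)).
  apply: (primrec_rec (h := fun y r (z : n.+1.-tuple nat) =>
    mu_step G (thead z) [tuple of behead z] y r)) => //.
    solve_primrec.
  rewrite /mu_step.
  have hG' : primrec_in F (fun z : n.+3.-tuple nat => G (thead [tuple of behead [tuple of behead z]])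
     [tuple of thead z :: [tuple of behead [tuple of behead [tuple of behead z]]]]).
    apply: (primrec_staged_app hG); first exact: (primrec_wk2 h0).
    apply: primrec_tuple_cons; first exact: primrec_wk2_0.
    move=> i; apply: (primrec_wk2 (u := fun z : n.+1.-tuple nat => tnth [tuple of behead z] i)).
    exact: (primrec_tuple_behead (w := id) (@primrec_tuple_id F _)).
  solve_primrec.
Qed.

(** * Expansions with nonzero digits *)

Local Open Scope classical_set_scope.
Local Open Scope ring_scope.

Definition partial_expansion (R : realType) (b : nat) (D k : nat -> nat) (n : nat) : R :=
  \sum_(1 <= i < n.+1) (D i)%:R * (b%:R : R) ^- k i.

Lemma partial_expansion0 (R : realType) b D k : partial_expansion R b D k 0 = 0.
Proof. by rewrite /partial_expansion big_geq. Qed.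

Lemma partial_expansionS (R : realType) b D k n : partial_expansion R b D k n.+1 =
  partial_expansion R b D k n + (D n.+1)%:R * (b%:R : R) ^- k n.+1.
Proof. by rewrite /partial_expansion big_nat_recr. Qed.

Lemma exprVn_le (R : realType) (b : nat) m n : (2 <= b)%N -> (m <= n)%N ->
  (b%:R : R) ^- n <= (b%:R : R) ^- m.
Proof.
move=> hb le; have b0 : (0 : R) < b%:R by rewrite ltr0n; lia.
rewrite lef_pV2 ?posrE ?exprn_gt0 // ler_weXn2l // ler1n; lia.
Qed.

Lemma exprVnS_le (R : realType) (b : nat) m n : (2 <= b)%N -> (m < n)%N ->
  (b%:R : R) * b%:R ^- n <= (b%:R : R) ^- m.
Proof.
case: n => // n hb le; have b0 : (b%:R : R) != 0 by rewrite pnatr_eq0; lia.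
by rewrite exprS invfM mulrA mulfV // mul1r exprVn_le.
Qed.

Lemma expansion_term_bounds (R : realType) (b : nat) (D k : nat -> nat) i :
  (2 <= b)%N -> (0 < D i < b)%N ->
  (b%:R : R) ^- k i <= (D i)%:R * b%:R ^- k i /\
  (D i)%:R * b%:R ^- k i + b%:R ^- k i <= b%:R * (b%:R : R) ^- k i.
Proof.
move=> hb /andP[D0 Db].
have b0 : 0 < (b%:R : R) ^- k i by rewrite invr_gt0 exprn_gt0 // ltr0n; lia.
split; first by rewrite ler_peMl ?ler1n // ltW.
by rewrite -{2}[b%:R ^- k i]mul1r -mulrDl ler_wpM2r ?(ltW b0) // natr1 ler_nat.
Qed.

Lemma base_expansion_remainder (R : realType) b (alpha : R) D k : (2 <= b)%N ->
  base_expansion b alpha D k -> forall n,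
  0 < alpha - partial_expansion R b D k n.+1 <= (b%:R : R) ^- k n.+1.
Proof.
move=> hb [hD k1 hk cv] n.
have b0 m : 0 < (b%:R : R) ^- k m by rewrite invr_gt0 exprn_gt0 // ltr0n; lia.
have term0 m : 0 < (D m.+1)%:R * (b%:R : R) ^- k m.+1.
  by have [+ _] := expansion_term_bounds R k hb (hD m.+1 isT); apply: lt_le_trans.
have inc : nondecreasing_seq (partial_expansion R b D k).
  by apply/nondecreasing_seqP => m; rewrite partial_expansionS lerDl ltW.
(* Subtracting [b ^- k m] makes the induction work: the next term is at most
   [(b - 1) * b ^- k m.+1], which is at most [b ^- k m - b ^- k m.+1]. *)
have up m : (n.+1 <= m)%N -> partial_expansion R b D k m <=
   partial_expansion R b D k n.+1 + b%:R ^- k n.+1 - b%:R ^- k m.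
  elim: m => // m IH; rewrite leq_eqVlt => /orP[/eqP <-|]; first by rewrite addrK.
  rewrite ltnS => lem; have {}IH := IH lem.
  have m0 : (0 < m)%N by lia.
  have [_ h] := expansion_term_bounds R k hb (hD m.+1 isT).
  have h2 := exprVnS_le R hb (hk m m0).
  rewrite partial_expansionS; lra.
have cv' : (partial_expansion R b D k @ \oo --> alpha) by [].
apply/andP; split.
  have : partial_expansion R b D k n.+2 <= alpha.
    by rewrite -(cvg_lim _ cv') //; apply: nondecreasing_cvgn_le => //; apply: cvgP cv'.
  by rewrite partial_expansionS; have := term0 n.+1; lra.
rewrite lerBlDl; apply: (cvgr_to_le cv').
exists n.+1 => // m /= /up; have := b0 m; lra.
Qed.

(** For digits [D] from 1 to [b - 1] and arbitrary exponents [k], these half-open intervals are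
    pairwise disjoint, so the remainder determines the next digit and exponent. *)
Lemma base_expansion_next (R : realType) b (alpha : R) D k : (2 <= b)%N ->
  base_expansion b alpha D k -> forall n,
  (D n.+1)%:R * (b%:R : R) ^- k n.+1 < alpha - partial_expansion R b D k n
    <= (D n.+1).+1%:R * (b%:R : R) ^- k n.+1.
Proof.
move=> hb hexp n; have := base_expansion_remainder hb hexp n.
by rewrite partial_expansionS -natr1 mulrDl mul1r => /andP[h1 h2]; apply/andP; lra.
Qed.

Lemma leading_exponent_le (R : realType) (b D D' k k' : nat) (rho : R) :
  (2 <= b)%N -> (0 < D)%N -> (D' < b)%N ->
  D%:R * (b%:R : R) ^- k < rho -> rho <= D'.+1%:R * (b%:R : R) ^- k' ->
  (k' <= k)%N.
Proof.
move=> hb D0 Db h1 h2; rewrite leqNgt; apply/negP => lt.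
have := lt_le_trans h1 h2; apply/negP; rewrite -leNgt.
apply: (@le_trans _ _ (b%:R * b%:R ^- k')).
  by rewrite ler_wpM2r ?invr_ge0 ?exprn_ge0 // ler_nat.
apply: le_trans (exprVnS_le R hb lt) _.
by rewrite ler_peMl ?ler1n // invr_ge0 exprn_ge0.
Qed.

(** By induction the partial sums agree, so both expansions face the same remainder, which fixes
    first the exponent and then the digit. *)
Lemma base_expansion_unique (R : realType) b (alpha : R) D k D' k' :
  (2 <= b)%N -> base_expansion b alpha D k -> base_expansion b alpha D' k' ->
  forall i, D i.+1 = D' i.+1 /\ k i.+1 = k' i.+1.
Proof.
move=> hb hexp hexp'.
have H n : partial_expansion R b D k n = partial_expansion R b D' k' n ->
    D n.+1 = D' n.+1 /\ k n.+1 = k' n.+1.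
  move=> eP.
  have /andP[h1 h2] := base_expansion_next hb hexp n.
  have /andP[h1' h2'] := base_expansion_next hb hexp' n.
  rewrite -eP in h1' h2'.
  have [/(_ n.+1 isT)/andP[D0 Db] _ _ _] := hexp.
  have [/(_ n.+1 isT)/andP[D0' Db'] _ _ _] := hexp'.
  have ek : k n.+1 = k' n.+1.
    by apply/eqP; rewrite eqn_leq (leading_exponent_le hb D0' Db h1' h2)
      (leading_exponent_le hb D0 Db' h1 h2').
  split=> //; rewrite ek in h1 h2.
  have b0 : 0 < (b%:R : R) ^- k' n.+1 by rewrite invr_gt0 exprn_gt0 // ltr0n; lia.
  have := lt_le_trans h1 h2'; have := lt_le_trans h1' h2.
  rewrite !ltr_pM2r // !ltr_nat; lia.
move=> n; apply: (H n); elim: n => [|n IH]; first by rewrite !partial_expansion0.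
by have [eD ek] := H _ IH; rewrite !partial_expansionS IH eD ek.
Qed.

Lemma is_sum_approx_unique (R : realType) b (alpha : R) A A' : (2 <= b)%N ->
  is_sum_approx b alpha A -> is_sum_approx b alpha A' -> A = A'.
Proof.
move=> hb [D [k [h A0 hA]]] [D' [k' [h' A0' hA']]].
apply/funext => -[|i]; first by rewrite A0 A0'.
by rewrite hA // hA' //; have [-> ->] := base_expansion_unique hb h h' i.
Qed.

Lemma sum_approx_belowE (R : realType) b (alpha : R) A : (2 <= b)%N ->
  is_sum_approx b alpha A -> sum_approx_below b alpha = A.
Proof.
move=> hb hA; apply: xget_unique => // A' hA'.
exact: is_sum_approx_unique hA' hA.
Qed.

Lemma increasing_exponent_ge (k : nat -> nat) : (0 < k 1)%N ->
  (forall i, (0 < i)%N -> (k i < k i.+1)%N) -> forall n, (n < k n.+1)%N.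
Proof.
move=> k1 hk; elim=> [//|n IH]; exact: leq_ltn_trans IH (hk n.+1 isT).
Qed.

Lemma base_expansion_of_remainder (R : realType) b (alpha : R) D k :
  (2 <= b)%N -> (forall i, (0 < i)%N -> (0 < D i < b)%N) -> (0 < k 1)%N ->
  (forall i, (0 < i)%N -> (k i < k i.+1)%N) ->
  (forall n, 0 <= alpha - partial_expansion R b D k n.+1 <= (b%:R : R) ^- k n.+1) ->
  base_expansion b alpha D k.
Proof.
move=> hb hD k1 hk hrem; split=> //.
rewrite -(cvg_shiftS (partial_expansion R b D k)).
have half1 : `|2%:R^-1 : R| < 1 by rewrite ger0_norm; lra.
(* Squeezing works with powers of one half because [k n.+1] exceeds [n] and [b] is at least 2. *)
have cv0 : alpha - (2%:R^-1 : R) ^+ n @[n --> \oo] --> alpha.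
  by rewrite -[X in _ --> X]subr0; apply: cvgB; [exact: cvg_cst | exact: cvg_expr].
apply: squeeze_cvgr cv0 (cvg_cst alpha).
apply: nearW => n /=; have /andP[h1 h2] := hrem n.
apply/andP; split; last by rewrite -subr_ge0.
rewrite lerBlDr -lerBlDl (le_trans h2) // exprVn.
apply: le_trans (exprVn_le R hb (ltnW (increasing_exponent_ge k1 hk n))) _.
have b0 : (0 : R) < b%:R by rewrite ltr0n; lia.
by rewrite lef_pV2 ?posrE ?exprn_gt0 // lerXn2r ?nnegrE ?ler0n ?ler_nat.
Qed.

(** Here [a p] is the ceiling of [alpha * b ^ p] minus 1, the integer formed by the first [p] digits
    of the nonterminating expansion. The last two hypotheses say that the digit at [k n.+1] is
    nonzero and that those strictly between [k n] and [k n.+1] vanish. *)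
Lemma base_expansion_of_ceil (R : realType) b (alpha : R) (a k : nat -> nat) :
  (2 <= b)%N ->
  (forall p, (a p)%:R < alpha * b%:R ^+ p <= (a p).+1%:R) ->
  a 0%N = 0%N -> k 0%N = 0%N -> (forall n, (k n < k n.+1)%N) ->
  (forall n, (b ^ (k n.+1 - k n) * a (k n) < a (k n.+1))%N) ->
  (forall n, a (k n.+1).-1 = (b ^ ((k n.+1).-1 - k n) * a (k n))%N) ->
  base_expansion b alpha
    (fun n => a (k n) - b ^ (k n - k n.-1) * a (k n.-1))%N k.
Proof.
move=> hb ha a0 k0 hk hpos hmin; set D := fun n => _.
have bn0 : (b%:R : R) != 0 by rewrite pnatr_eq0; lia.
have b0 : (0 : R) < b%:R by rewrite ltr0n; lia.
(* The sum telescopes, as each digit is the truncation at [k n.+1] minus the rescaled one at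
   [k n]. *)
have PE n : partial_expansion R b D k n = (a (k n))%:R / b%:R ^+ k n.
  elim: n => [|n IH]; first by rewrite partial_expansion0 k0 a0 mul0r.
  rewrite partial_expansionS IH /D /= natrB; last exact: ltnW.
  rewrite natrM natrX mulrBl addrC -[RHS]subr0 -addrA; congr (_ + _).
  rewrite -{2}(subnKC (ltnW (hk n))) exprD; field.
  by rewrite !expf_neq0.
apply: base_expansion_of_remainder => //.
- case=> // n _; rewrite /D /= subn_gt0 hpos /=.
  have e : (b ^ (k n.+1 - k n) * a (k n) = b * a (k n.+1).-1)%N.
    by rewrite hmin mulnA -expnS; congr (_ ^ _ * _)%N; have := hk n; lia.
  have : (a (k n.+1) < b * (a (k n.+1).-1).+1)%N.
    rewrite -(ltr_nat R) natrM.
    have /andP[+ _] := ha (k n.+1); move=> /lt_le_trans; apply.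
    have kn : k n.+1 = (k n.+1).-1.+1 by have := hk n; lia.
    rewrite [in X in X <= _]kn exprS mulrCA ler_pM2l //.
    by have /andP[] := ha (k n.+1).-1.
  rewrite e mulnS; have := hpos n; rewrite e; lia.
- by have := hk 0%N; rewrite k0.
- move=> n; have /andP[h1 h2] := ha (k n.+1).
  have bk : 0 < (b%:R : R) ^+ k n.+1 by rewrite exprn_gt0.
  rewrite PE subr_ge0 ler_pdivrMr // (ltW h1) /=.
  by rewrite lerBlDr -[X in _ <= X + _]mul1r -mulrDl nat1r ler_pdivlMr.
Qed.

(** * Sparse binary sums *)

Definition sparse_sum (R : realType) (e : nat -> bool) (L : nat) : R :=
  \sum_(0 <= t < L.+1) (e t)%:R * (2%:R : R) ^- (4 ^ t).

Definition sparse_real (R : realType) (e : nat -> bool) : R :=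
  limn (sparse_sum R e).

(** The numerator of [sparse_sum] over the denominator [2 ^ 4 ^ L], given by a recursion on naturals
    so that primitive recursiveness is immediate. *)
Definition sparse_num (e : nat -> bool) (L : nat) : nat :=
  nat_rect (fun _ => nat) (e 0%N : nat)
    (fun m r => r * 2 ^ (4 ^ m.+1 - 4 ^ m) + e m.+1)%N L.

Lemma sparse_sumS (R : realType) e L : sparse_sum R e L.+1 =
  sparse_sum R e L + (e L.+1)%:R * (2%:R : R) ^- (4 ^ L.+1).
Proof. by rewrite /sparse_sum big_nat_recr. Qed.

Lemma sparse_sumE (R : realType) e L :
  sparse_sum R e L = (sparse_num e L)%:R / (2%:R : R) ^+ (4 ^ L).
Proof.
have two0 : (2%:R : R) != 0 by rewrite pnatr_eq0.
elim: L => [|L IH]; first by rewrite /sparse_sum big_nat1.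
rewrite sparse_sumS IH /= natrD natrM natrX mulrDl; congr (_ + _).
have le : (4 ^ L <= 4 ^ L.+1)%N by rewrite leq_pexp2l.
rewrite -{2}(subnKC le) exprD; field.
by rewrite !expf_neq0.
Qed.

Lemma sparse_sum_nondecreasing (R : realType) e : nondecreasing_seq (sparse_sum R e).
Proof.
apply/nondecreasing_seqP => m; by rewrite sparse_sumS lerDl mulr_ge0 ?invr_ge0 ?exprn_ge0.
Qed.

Lemma sparse_gap_le (R : realType) L :
  2%:R * (2%:R : R) ^- (4 ^ L.+1) <= (2%:R : R) ^- (4 ^ L).
Proof.
by apply: exprVnS_le => //; rewrite ltn_exp2l.
Qed.

(** A partial sum plus twice the next possible term is nonincreasing: that term itself is absorbed
    once, and the second copy covers the new allowance. *)
Lemma sparse_sum_le (R : realType) e L m : (L <= m)%N ->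
  sparse_sum R e m + 2%:R * (2%:R : R) ^- (4 ^ m.+1) <=
  sparse_sum R e L + 2%:R * (2%:R : R) ^- (4 ^ L.+1).
Proof.
elim: m => [|m IH]; first by rewrite leqn0 => /eqP ->.
rewrite leq_eqVlt => /orP[/eqP <- //|lt]; apply: le_trans (IH lt).
rewrite sparse_sumS; have := sparse_gap_le R m.+1.
have : 0 <= (2%:R : R) ^- (4 ^ m.+1) by rewrite invr_ge0 exprn_ge0.
case: (e _) => /=; lra.
Qed.

Lemma sparse_sum_le_bound (R : realType) e L m :
  sparse_sum R e m <= sparse_sum R e L + 2%:R * (2%:R : R) ^- (4 ^ L.+1).
Proof.
have [le|/ltnW le] := leqP L m.
  apply: le_trans (sparse_sum_le R e le).
  by rewrite lerDl mulr_ge0 ?invr_ge0 ?exprn_ge0.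
apply: le_trans (sparse_sum_nondecreasing R e le) _.
by rewrite lerDl mulr_ge0 ?invr_ge0 ?exprn_ge0.
Qed.

Lemma sparse_sum_cvg (R : realType) e : sparse_sum R e @ \oo --> sparse_real R e.
Proof.
apply: nondecreasing_is_cvgn; first exact: sparse_sum_nondecreasing.
exists (sparse_sum R e 0 + 2%:R * (2%:R : R) ^- (4 ^ 1)) => _ [m _ <-].
exact: sparse_sum_le_bound.
Qed.

Lemma sparse_real_ge (R : realType) e L : sparse_sum R e L <= sparse_real R e.
Proof.
apply: nondecreasing_cvgn_le; first exact: sparse_sum_nondecreasing.
exact: cvgP (@sparse_sum_cvg R e).
Qed.

Lemma sparse_real_le (R : realType) e L :
  sparse_real R e <= sparse_sum R e L + 2%:R * (2%:R : R) ^- (4 ^ L.+1).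
Proof.
apply: (cvgr_to_le (@sparse_sum_cvg R e)).
by apply: nearW => m; exact: sparse_sum_le_bound.
Qed.

Lemma sparse_real_gt (R : realType) (e : nat -> bool) L t : (L < t)%N -> e t ->
  sparse_sum R e L < sparse_real R e.
Proof.
case: t => // t; rewrite ltnS => lt et; apply: lt_le_trans (sparse_real_ge R e t.+1).
rewrite sparse_sumS et mul1r (le_lt_trans (sparse_sum_nondecreasing R e lt)) //.
by rewrite ltrDl invr_gt0 exprn_gt0.
Qed.

Lemma sparse_real_lt1 (R : realType) e : sparse_real R e < 1.
Proof.
apply: le_lt_trans (sparse_real_le R e 0) _.
rewrite /sparse_sum big_nat1 expr1 -[(4 ^ 1)%N]/4%N.
by case: (e 0%N) => /=; rewrite !exprS expr0; lra.
Qed.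

(** * Positivity and irrationality of the sparse sums *)

Definition unbounded_events (e : nat -> bool) : Prop :=
  forall L, exists2 t, (L < t)%N & e t.

Lemma sparse_real_gt0 (R : realType) e : unbounded_events e -> 0 < sparse_real R e.
Proof.
move=> he; have [t lt et] := he 0%N; apply: le_lt_trans (sparse_real_gt R lt et).
by rewrite /sparse_sum big_nat1 mulr_ge0 // invr_ge0 exprn_ge0.
Qed.

Lemma expn4_gap L : (L + 2 + 4 ^ L <= 4 ^ L.+1)%N.
Proof. by rewrite expnS; elim: L => [//|L IH]; rewrite expnS; lia. Qed.

(* A rational with denominator b cannot be approximated by fractions with
   denominator M := 2 ^ 4 ^ b from below better than 1 / (b * M), whereas the
   tail of the series is at most 2 / M ^ 4. *)
Lemma sparse_real_irrational (R : realType) e :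
  unbounded_events e -> irrational (sparse_real R e).
Proof.
move=> he /rationalP [a [b eab]].
have g0 := sparse_real_gt0 R he.
have b0 : (0 < b)%N.
  by case: b eab => // eab; move: g0; rewrite eab invr0 mulr0 ltxx.
have [t lt et] := he b.
have lo := sparse_real_gt R lt et; have hi := sparse_real_le R e b.
pose M := (2 ^ (4 ^ b))%N.
have M0 : (0 : R) < M%:R by rewrite ltr0n expn_gt0.
have b0' : (0 : R) < b%:R by rewrite ltr0n.
have SE : sparse_sum R e b = (sparse_num e b)%:R / M%:R.
  by rewrite sparse_sumE natrX.
pose x : int := a * M%:Z - (sparse_num e b)%:Z * b%:Z.
have xE : x%:~R = (sparse_real R e - sparse_sum R e b) * b%:R * M%:R :> R.
  rewrite SE eab /x rmorphB !rmorphM /=; field.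
  by rewrite !gt_eqF.
have x1 : 1 <= x%:~R :> R.
  suff : 0 < x%:~R :> R by rewrite ltr0z ler1z; lia.
  by rewrite xE !mulr_gt0 // subr_gt0.
have : x%:~R < 1 :> R; last by rewrite ltNge x1.
(* The bound [1 / (2 ^ b.+1 * M)] suffices, because [b < 2 ^ b.+1] makes its product with [b * M]
   smaller than 1. *)
have tail : sparse_real R e - sparse_sum R e b <= (2 ^ (b.+1 + 4 ^ b))%:R^-1.
  rewrite lerBlDl (le_trans hi) // lerD2l natrX.
  apply: (@le_trans _ _ (2%:R * 2%:R ^- (b.+1 + 4 ^ b).+1)).
    by rewrite ler_pM2l // exprVn_le //; have := expn4_gap b; lia.
  exact: exprVnS_le.
rewrite xE -mulrA.
apply: (@le_lt_trans _ _ ((2 ^ (b.+1 + 4 ^ b))%:R^-1 * (b%:R * M%:R))).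
  by rewrite ler_wpM2r // mulr_ge0 // ltW.
rewrite mulrC ltr_pdivrMr ?ltr0n ?expn_gt0 // mul1r -natrM ltr_nat expnD.
by rewrite ltn_pmul2r ?expn_gt0 // (ltn_trans (ltn_expl b (isT : 1 < 2)%N)) // ltn_exp2l.
Qed.

(** The floor of [x * b ^ p] for the sparse sum [x]. The cut-off [b * p] is chosen because
    [b ^ p <= 2 ^ (b * p)], a factor that the gap after the term [b * p] absorbs. *)
Definition sparse_floor (e : nat -> bool) (b p : nat) : nat :=
  (sparse_num e (b * p) * b ^ p) %/ 2 ^ (4 ^ (b * p)).

(** Put [L = b * p] and [M = 2 ^ 4 ^ L]. The truncated product has denominator [M], so it lies at
    least [1 / M] below the next integer; the omitted tail contributes at most [1 / (2 * M)], and
    the other half remains as an explicit margin. *)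
Lemma sparse_floorP (R : realType) e b p :
  (sparse_floor e b p)%:R <= sparse_real R e * b%:R ^+ p /\
  sparse_real R e * b%:R ^+ p + 2%:R ^- (4 ^ (b * p)).+1 <= (sparse_floor e b p).+1%:R.
Proof.
rewrite /sparse_floor; set L := (b * p)%N; set M := (2 ^ (4 ^ L))%N.
set N := sparse_num e L; set c := (_ %/ _)%N.
have M0 : (0 < M)%N by rewrite expn_gt0.
have M0' : (0 : R) < M%:R by rewrite ltr0n.
have SE : sparse_sum R e L = N%:R / M%:R by rewrite sparse_sumE natrX.
have lo := sparse_real_ge R e L; have hi := sparse_real_le R e L.
have bp0 : 0 <= (b%:R : R) ^+ p by rewrite exprn_ge0.
have bpL : (b%:R : R) ^+ p <= 2%:R ^+ L.
  by rewrite /L exprM lerXn2r ?nnegrE ?exprn_ge0 ?ler0n // -natrX ler_nat ltnW // ltn_expl.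
split.
  apply: le_trans (ler_wpM2r bp0 lo); rewrite SE mulrAC ler_pdivlMr //.
  by rewrite -natrX -!natrM ler_nat leq_divM.
have hi' := ler_wpM2r bp0 hi; rewrite mulrDl SE in hi'.
have h1 : N%:R / M%:R * b%:R ^+ p <= c.+1%:R - M%:R^-1 :> R.
  rewrite mulrAC ler_pdivrMr // mulrBl mulVf ?gt_eqF //.
  by rewrite lerBrDr -natrX -!natrM natr1 ler_nat ltn_ceil.
have h2 : 2%:R * 2%:R ^- (4 ^ L.+1) * b%:R ^+ p <= (2%:R : R) ^- (4 ^ L).+1.
  apply: (@le_trans _ _ (2%:R * 2%:R ^- (4 ^ L.+1) * 2%:R ^+ L)).
    by rewrite ler_wpM2l // mulr_ge0 // invr_ge0 exprn_ge0.
  rewrite mulrAC -exprS ler_pdivrMr ?exprn_gt0 // mulrC.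
  rewrite ler_pdivlMr ?exprn_gt0 // -exprD ler_weXn2l ?ler1n //.
  by have := expn4_gap L; lia.
have h3 : 2%:R * 2%:R ^- (4 ^ L).+1 <= (M%:R)^-1 :> R.
  by rewrite /M natrX; apply: exprVnS_le.
lra.
Qed.

(** For [b >= 2] and the sparse sum [x], the ceiling of [(1 - x) * b ^ p] minus 1, that is, the base
    [b] truncation of [1 - x] at place [p]. *)
Definition sparse_ceil (e : nat -> bool) (b p : nat) : nat :=
  (b ^ p - (sparse_floor e b p).+1)%N.

Lemma sparse_ceilE (R : realType) e b p : (2 <= b)%N ->
  (sparse_ceil e b p)%:R = b%:R ^+ p - (sparse_floor e b p).+1%:R :> R.
Proof.
move=> hb; rewrite natrB ?natrX // -(ltr_nat R).
have [h _] := sparse_floorP R e b p; apply: (le_lt_trans h).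
rewrite natrX gtr_pMl ?sparse_real_lt1 // exprn_gt0 // ltr0n; lia.
Qed.

Lemma sparse_ceilP (R : realType) e b p : (2 <= b)%N ->
  (sparse_ceil e b p)%:R + 2%:R ^- (4 ^ (b * p)).+1 <=
    (1 - sparse_real R e) * b%:R ^+ p <= (sparse_ceil e b p).+1%:R.
Proof.
move=> hb; have [h1 h2] := sparse_floorP R e b p.
rewrite -[X in _ && (_ <= X)]natr1 sparse_ceilE // mulrBl mul1r.
by move: h2; rewrite -natr1 => h2; apply/andP; lra.
Qed.

Lemma sparse_ceil_lt (R : realType) e b p : (2 <= b)%N ->
  (sparse_ceil e b p)%:R < (1 - sparse_real R e) * b%:R ^+ p <= (sparse_ceil e b p).+1%:R.
Proof.
move=> hb; have /andP[h ->] := sparse_ceilP R e p hb; rewrite andbT.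
by apply: lt_le_trans h; rewrite ltrDl invr_gt0 exprn_gt0.
Qed.

Lemma sparse_ceil_scale_le (R : realType) e b p j : (2 <= b)%N ->
  (b ^ j * sparse_ceil e b p <= sparse_ceil e b (p + j))%N.
Proof.
move=> hb; have /andP[h _] := sparse_ceil_lt R e p hb.
have /andP[_ h'] := sparse_ceil_lt R e (p + j) hb.
rewrite -ltnS -(ltr_nat R) natrM natrX; apply: lt_le_trans h'.
by rewrite exprD mulrA mulrC ltr_pM2r // exprn_gt0 // ltr0n; lia.
Qed.

(** The margin of [sparse_ceilP] grows to at least 2 under this scaling, more than the unit error of
    a truncation. So a nonzero digit of [1 - x] must occur within the next [(4 ^ (b * p)).+2]
    places, which bounds the digit search. *)
Lemma sparse_ceil_scale_lt (R : realType) e b p : (2 <= b)%N ->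
  (b ^ (4 ^ (b * p)).+2 * sparse_ceil e b p <
    sparse_ceil e b (p + (4 ^ (b * p)).+2))%N.
Proof.
move=> hb; set j := (_.+2); have /andP[h _] := sparse_ceilP R e p hb.
have /andP[_ h'] := sparse_ceilP R e (p + j) hb.
have bj : (0 : R) < b%:R ^+ j by rewrite exprn_gt0 // ltr0n; lia.
have big : 2%:R <= 2%:R ^- (4 ^ (b * p)).+1 * b%:R ^+ j :> R.
  rewrite mulrC ler_pdivlMr ?exprn_gt0 // -exprS lerXn2r ?nnegrE ?ler0n //.
  by rewrite ler_nat.
rewrite -(ltr_nat R) natrM natrX mulrC.
move: h'; rewrite exprD mulrA -natr1; have := ler_wpM2r (ltW bj) h.
rewrite mulrDl; lra.
Qed.

Definition next_digit (e : nat -> bool) (b p : nat) : nat :=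
  p.+1 + bounded_search (fun j => ~~ (sparse_ceil e b (p.+1 + j) ==
                                   b ^ j.+1 * sparse_ceil e b p))%N
           (4 ^ (b * p)).+1.

Lemma next_digitP (R : realType) e b p : (2 <= b)%N ->
  [/\ (p < next_digit e b p)%N,
      (b ^ (next_digit e b p - p) * sparse_ceil e b p <
        sparse_ceil e b (next_digit e b p))%N &
      sparse_ceil e b (next_digit e b p).-1 =
        (b ^ ((next_digit e b p).-1 - p) * sparse_ceil e b p)%N].
Proof.
move=> hb; rewrite /next_digit; set P := fun j => _; set B := (4 ^ _).+1.
have PB : P B.
  rewrite /P addSnnS neq_ltn; apply/orP; right.
  exact: (sparse_ceil_scale_lt R e p hb).
have [] := bounded_searchP PB (leqnn B).
set s := bounded_search _ _ => Ps hs; split; first by rewrite addSn ltnS leq_addr.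
  rewrite (_ : (p.+1 + s - p = s.+1)%N); last by lia.
  rewrite ltn_neqAle eq_sym; move: Ps; rewrite /P => -> /=.
  by rewrite addSnnS; exact: (@sparse_ceil_scale_le R).
rewrite (_ : (p.+1 + s).-1 = (p + s)%N); last by lia.
(* If the search stops at 0, the next nonzero digit is at [p.+1] and nothing lies between; otherwise
   the last rejected candidate gives the equation. *)
rewrite addKn; case: s Ps hs => [|s] Ps hs; first by rewrite addn0 mul1n.
by have := hs s (ltnSn s); rewrite negbK addSnnS => /eqP.
Qed.

Definition digit_position (e : nat -> bool) (b n : nat) : nat :=
  nat_rect (fun _ => nat) 0%N (fun _ r => next_digit e b r) n.

Definition digit_value (e : nat -> bool) (b n : nat) : nat :=
  (sparse_ceil e b (digit_position e b n) -
   b ^ (digit_position e b n - digit_position e b n.-1) *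
   sparse_ceil e b (digit_position e b n.-1))%N.

Lemma gen_sum_below_1sparse (R : realType) e b n : (2 <= b)%N ->
  gen_sum_below (1 - sparse_real R e) b n =
  (digit_value e b n)%:R / (b ^ digit_position e b n)%:R.
Proof.
move=> hb; rewrite /gen_sum_below hb.
(* Natural subtraction truncates here, and this yields the prescribed value 0 of the approximation
   at index 0. *)
have c0 : sparse_ceil e b 0 = 0%N by rewrite /sparse_ceil expn0 subSS sub0n.
rewrite (@sum_approx_belowE _ _ _ (fun n =>
  (digit_value e b n)%:R / (b ^ digit_position e b n)%:R)) //.
exists (digit_value e b), (digit_position e b); split; first last.
- by move=> i _; rewrite natrX.
- by rewrite /digit_value /= c0 sub0n mul0r.
apply: (@base_expansion_of_ceil _ _ _ (sparse_ceil e b)) => //.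
- by move=> p; exact: sparse_ceil_lt.
- by move=> m; have [] := next_digitP R e (digit_position e b m) hb.
- by move=> m; have [] := next_digitP R e (digit_position e b m) hb.
- by move=> m; have [] := next_digitP R e (digit_position e b m) hb.
Qed.

(** The defining series is already the binary expansion: every digit is 1 and the exponents are
    [4 ^ t i]. Events are numbered from 0 and expansion terms from 1, hence the shift. *)
Lemma gen_sum_below_sparse2 (R : realType) (e : nat -> bool) (t : nat -> nat) :
  (forall i, (t i < t i.+1)%N) -> (forall i, e (t i)) ->
  (forall m, e m -> exists i, m = t i) ->
  forall n, gen_sum_below (sparse_real R e) 2 n.+1 = (2 ^ (4 ^ t n))%:R^-1.
Proof.
move=> tS et te n; rewrite /gen_sum_below /=.
have t_mono i j : (i < j)%N -> (t i < t j)%N.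
  elim: j => // j IH; rewrite ltnS leq_eqVlt => /orP[/eqP-> //|/IH]; by move/ltn_trans; apply.
pose k i := (4 ^ t i.-1)%N; pose D (i : nat) := 1%N.
rewrite (@sum_approx_belowE _ _ _ (fun i => if i is 0%N then 0 else (2 ^ k i)%:R^-1)) //.
exists D, k; split=> //; last by case=> // i _; rewrite mul1r natrX.
have PE i : partial_expansion R 2 D k i.+1 = sparse_sum R e (t i).
  have no_event l m : (forall s, (l <= s < m)%N -> e s = false) ->
      \sum_(l <= s < m) (e s)%:R * (2%:R : R) ^- (4 ^ s) = 0.
    by move=> h; rewrite big_nat big1 // => s /h ->; rewrite mul0r.
  elim: i => [|i IH].
    rewrite partial_expansionS partial_expansion0 add0r /sparse_sum.
    rewrite big_nat_recr //= no_event ?add0r ?et // => s /andP[_ lts].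
    apply/negP => /te [[|j] ej]; first by rewrite ej ltnn in lts.
    by have := t_mono 0%N j.+1 isT; rewrite -ej => /(ltn_trans lts); rewrite ltnn.
  rewrite partial_expansionS IH /sparse_sum [RHS](@big_cat_nat _ _ _ (t i).+1) //=; last first.
    by rewrite ltnW // ltnS.
  congr (_ + _).
  rewrite big_nat_recr //= no_event ?add0r ?et // => s /andP[gts lts].
  (* An event strictly between two consecutive ones would be some [t j], with [j <= i] or [i < j];
     monotonicity excludes both. *)
  apply/negP => /te [j ej]; rewrite ej in gts lts.
  have [le|lt] := leqP j i.
    have : (t j <= t i)%N by move: le; rewrite leq_eqVlt => /orP[/eqP->//|/t_mono/ltnW].
    by lia.
  have : (t i.+1 <= t j)%N by move: lt; rewrite leq_eqVlt => /orP[/eqP->//|/t_mono/ltnW].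
  by lia.
apply: base_expansion_of_remainder => //.
- by rewrite expn_gt0.
- by case=> // i _; rewrite /k ltn_exp2l.
- move=> i; rewrite PE; have := sparse_real_ge R e (t i); have := sparse_real_le R e (t i).
  have := sparse_gap_le R (t i); rewrite /k /=.
  by move=> *; apply/andP; split; lra.
Qed.

(** * The separating number *)

(** Phrased by composition, so that [e] can be used in any list of parameters without passing
    through unary tuples. *)
Definition primrec_seq F (e : nat -> bool) : Prop :=
  forall n (u : natfun n), primrec_in F u -> primrec_in F (fun x => e (u x) : nat).

Lemma primrec_sparse_num F e n (u : natfun n) : primrec_seq F e ->
  primrec_in F u -> primrec_in F (fun x => sparse_num e (u x)).
Proof.
move=> he hu.
apply: (primrec_rec (h := fun m r _ => r * 2 ^ (4 ^ m.+1 - 4 ^ m) + e m.+1)%N) => //.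
  exact: (he _ (fun=> 0%N) (primrec_const _ _ _)).
by apply: primrec_add; [solve_primrec | apply: he; solve_primrec].
Qed.

Lemma primrec_sparse_ceil F e n (u v : natfun n) : primrec_seq F e ->
  primrec_in F u -> primrec_in F v ->
  primrec_in F (fun x => sparse_ceil e (u x) (v x)).
Proof.
move=> he hu hv; rewrite /sparse_ceil /sparse_floor.
have h := primrec_sparse_num he (primrec_mul hu hv).
solve_primrec.
Qed.

Lemma primrec_next_digit F e n (u v : natfun n) : primrec_seq F e ->
  primrec_in F u -> primrec_in F v ->
  primrec_in F (fun x => next_digit e (u x) (v x)).
Proof.
move=> he hu hv; rewrite /next_digit; apply: primrec_add; first by solve_primrec.
apply: (primrec_search (P := fun j x => ~~ (sparse_ceil e (u x) ((v x).+1 + j) ==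
  u x ^ j.+1 * sparse_ceil e (u x) (v x)))%N); last by solve_primrec.
apply: primrec_neg; apply: primrec_eq.
  by apply: primrec_sparse_ceil; solve_primrec.
by apply: primrec_mul; [solve_primrec | apply: primrec_sparse_ceil; solve_primrec].
Qed.

Lemma primrec_digit_position F e n (u v : natfun n) : primrec_seq F e ->
  primrec_in F u -> primrec_in F v ->
  primrec_in F (fun x => digit_position e (u x) (v x)).
Proof.
move=> he hu hv.
apply: (primrec_rec (h := fun _ r x => next_digit e (u x) r)) => //.
  exact: primrec_const.
by apply: primrec_next_digit; solve_primrec.
Qed.

Lemma primrec_digit_value F e n (u v : natfun n) : primrec_seq F e ->
  primrec_in F u -> primrec_in F v ->
  primrec_in F (fun x => digit_value e (u x) (v x)).
Proof.
move=> he hu hv; rewrite /digit_value.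
have hp := primrec_digit_position he hu hv.
have hq := primrec_digit_position he hu (primrec_pred hv).
have hcp := primrec_sparse_ceil he hu hp.
have hcq := primrec_sparse_ceil he hu hq.
solve_primrec.
Qed.

(** The sequence code of the numerator and denominator of [n / m] in lowest terms, each doubled as
    [int_code] does for nonnegative integers. *)
Definition frac_code (n m : nat) : nat :=
  (2 ^ (2 * (n %/ gcdn n m)) * (2 * 2 ^ (2 * (m %/ gcdn n m))).+1)%N.

Lemma rat_code_frac n m : (0 < m)%N -> rat_code (n%:R / m%:R) = frac_code n m.
Proof.
move=> m0; have g0 : (0 < gcdn n m)%N by rewrite gcdn_gt0 m0 orbT.
set g := gcdn n m in g0.
have en : n = (n %/ g * g)%N by rewrite divnK ?dvdn_gcdl.
have em : m = (m %/ g * g)%N by rewrite divnK ?dvdn_gcdr.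
have m'0 : (0 < m %/ g)%N by rewrite divn_gt0 // dvdn_leq // dvdn_gcdr.
have cop : coprime (n %/ g) (m %/ g).
  by rewrite /coprime -(eqn_pmul2r g0) mul1n muln_gcdl -em -en.
have -> : n%:R / m%:R = (Posz (n %/ g))%:~R / (Posz (m %/ g))%:~R :> rat.
  rewrite [in LHS]en [in LHS]em !natrM invfM mulrACA mulfV ?mulr1 //.
  by rewrite pnatr_eq0 -lt0n.
rewrite /rat_code coprimeq_num // coprimeq_den //.
rewrite gtr0_sg ?ltz_nat // mul1r gt_eqF ?ltz_nat //.
by rewrite /frac_code /= muln1 !mul2n.
Qed.

Lemma primrec_frac_code F n (u v : natfun n) :
  primrec_in F u -> primrec_in F v -> primrec_in F (fun x => frac_code (u x) (v x)).
Proof.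
move=> hu hv; rewrite /frac_code; have hg := primrec_gcd hu hv.
solve_primrec.
Qed.

Lemma primrec_gen_sum_below_1sparse (R : realType) F e : primrec_seq F e ->
  primrec_in F (fun2 (fun b n => rat_code (gen_sum_below (1 - sparse_real R e) b n))).
Proof.
move=> he.
have hb : primrec_in F (fun x : 2.-tuple nat => tnth x ord0) by exact: PR_proj.
have hn : primrec_in F (fun x : 2.-tuple nat => tnth x ord_max) by exact: PR_proj.
apply: (primrec_ext (g := fun x : 2.-tuple nat => if (2 <= tnth x ord0)%N then
  frac_code (digit_value e (tnth x ord0) (tnth x ord_max))
    (tnth x ord0 ^ digit_position e (tnth x ord0) (tnth x ord_max)) else frac_code 0 1)).
  move=> x; rewrite /fun2; case: ifP => h2.
    by rewrite gen_sum_below_1sparse // rat_code_frac // expn_gt0 (ltn_trans _ h2).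
  (* For bases below 2 the value 0 is coded as the fraction [0 / 1]. *)
  by rewrite /gen_sum_below h2 -rat_code_frac // mul0r.
apply: primrec_if; [solve_primrec| |solve_primrec].
have hv := primrec_digit_value he hb hn.
have hp := primrec_digit_position he hb hn.
by apply: primrec_frac_code; solve_primrec.
Qed.

(* [ready G t i] says that the diagonal value U i <i> has been computed by
   stage t and is below t; CodeSeq.code [:: i] = 2 ^ i. *)
Definition ready (G : nat -> natfun 2) (t i : nat) : bool :=
  (0 < G t [tuple i; 2 ^ i] <= t)%N.

(** The number of events before stage [t], which is also the index whose diagonal value is awaited
    at that stage. *)
Definition event_count (G : nat -> natfun 2) (t : nat) : nat :=
  nat_rect (fun _ => nat) 0%N (fun s r => r + ready G s r)%N t.

Definition event (G : nat -> natfun 2) (t : nat) : bool := ready G t (event_count G t).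

Lemma primrec_event F G : primrec_staged F G -> primrec_seq F (event G).
Proof.
move=> hG.
have hr n (u v : natfun n) : primrec_in F u -> primrec_in F v ->
    primrec_in F (fun x => ready G (u x) (v x) : nat).
  move=> hu hv.
  have h : primrec_in F (fun x => G (u x) [tuple v x; 2 ^ v x]%N).
    apply: (primrec_staged_app hG) => //.
    apply: (primrec_tuple_cons (w := fun x => [tuple 2 ^ v x]%N)) => //.
    apply: (primrec_tuple_cons (w := fun x => [tuple])); first by solve_primrec.
    by case.
  by apply: primrec_and; apply: primrec_leq; solve_primrec.
move=> n u hu; apply: (hr) => //.
apply: (primrec_rec (h := fun s r _ => r + ready G s r)%N) => //; first by solve_primrec.
by apply: primrec_add; [solve_primrec | apply: hr; solve_primrec].
Qed.

Lemma event_count_mono G s t : (s <= t)%N -> (event_count G s <= event_count G t)%N.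
Proof.
move/subnK <-; elim: (t - s)%N => // d IH; rewrite addSn /=.
exact: leq_trans IH (leq_addr _ _).
Qed.

(** No index is awaited forever: its diagonal value is defined, so it is ready at some stage. At the
    first such stage after the count reached [i], the count is still [i]. *)
Lemma event_at_count (G : nat -> natfun 2) (f : natfun 2) : stage_approx f G ->
  forall i, exists2 t, event G t & event_count G t = i.
Proof.
move=> [_ G2].
have next i t0 : event_count G t0 = i -> exists2 t, event G t & event_count G t = i.
  move=> e0; have [t1 ht1] := G2 [tuple i; 2 ^ i]%N.
  pose Q t := (t0 <= t)%N && ready G t i.
  have exQ : exists t, Q t.
    (* Past [t0], past the convergence stage [t1], and large enough to exceed the computed value. *)
    exists (t0 + t1 + (f [tuple i; 2 ^ i]%N).+1)%N.
    rewrite /Q /ready ht1; last by lia.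
    by apply/andP; split; lia.
  case: (ex_minnP exQ) => t /andP[le0 rt] tmin.
  have ct s : (t0 <= s)%N -> (s <= t)%N -> event_count G s = i.
    elim: s => [|s IH]; first by rewrite leqn0 => /eqP <-.
    rewrite leq_eqVlt => /orP[/eqP <- //|le1] le2 /=.
    rewrite IH ?(ltnW le2) //.
    case: (boolP (ready G s i)) => [rs|]; last by rewrite addn0.
    by have := tmin s; rewrite /Q rs andbT => /(_ le1); lia.
  exists t; last exact: ct.
  by rewrite /event ct.
elim=> [|i [t et ct]]; first exact: (next _ 0%N).
by apply: (next _ t.+1); move: et; rewrite /event /= ct => ->; rewrite addn1.
Qed.

Lemma event_unique G s t : event G s -> event G t ->
  event_count G s = event_count G t -> s = t.
Proof.
wlog lt : s t / (s < t)%N => [H|es et ec].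
  by case: (ltngtP s t) => // lt es et ec; [|symmetry]; apply: H.
by have := event_count_mono G lt; rewrite /= -ec -/(event G s) es; lia.
Qed.

Lemma event_times (G : nat -> natfun 2) (f : natfun 2) : stage_approx f G ->
  exists t : nat -> nat,
    [/\ forall i, (t i < t i.+1)%N, forall i, event G (t i),
        forall m, event G m -> exists i, m = t i &
        forall i, (f [tuple i; 2 ^ i]%N < t i)%N].
Proof.
move=> aG.
have [t ht] := choice (fun i => let: ex_intro2 t h1 h2 := event_at_count aG i in
  ex_intro (fun t => event G t /\ event_count G t = i) t (conj h1 h2)).
exists t; split=> [i|i|m em|i].
- rewrite ltnNge; apply/negP => /(event_count_mono G).
  by rewrite (ht i).2 (ht i.+1).2 ltnn.
- exact: (ht i).1.
- exists (event_count G m); apply: (event_unique em); first exact: (ht _).1.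
  by rewrite (ht _).2.
(* Readiness excludes the undecided case, so the approximation equals [(f _).+1] and is at most
   [t i]. *)
have [+ ec] := ht i; rewrite /event ec /ready.
by case: (aG.1 (t i) [tuple i; 2 ^ i]%N) => ->.
Qed.

(** * Reflection and diagonalisation *)

Lemma irrational_1B (R : realType) (x : R) : irrational x -> irrational (1 - x).
Proof.
move=> hx [q _ eq]; apply: hx; exists (1 - q) => //.
by rewrite rmorphB rmorph1 /= eq subKr.
Qed.

Lemma irr01_1B (R : realType) (x : R) : irr01 x -> irr01 (1 - x).
Proof.
move=> [/andP[x0 x1] hx]; split; last exact: irrational_1B.
by apply/andP; split; lra.
Qed.

(** If the sums from below were in [C], the codes of their base 2 entries would form a unary
    function of [C] with some index [i]. Its value at [i] codes [1 / 2 ^ 4 ^ t i] and is thus at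
    least [t i], whereas the event at [t i] forces the diagonal value at [i] below [t i]. *)
Lemma sparse_separation (R : realType) (C : fun_class)
    (hC : subrecursive_class C) (hPR : closed_under_primrec C) :
  exists x : R, [/\ irr01 x, class_gdown C x & ~ class_gup C x].
Proof.
have [_ [ar [U [_ cU hU]]]] := hC; have [_ closedC] := hPR.
have [G hG aG] := computable_staged C cU.
have [t [tS et te tf]] := event_times aG.
have t_ge i : (i <= t i)%N by elim: i => // i IH; exact: leq_ltn_trans IH (tS i).
have he : unbounded_events (event G).
  by move=> L; exists (t L.+1); [exact: t_ge | exact: et].
have hirr : irr01 (sparse_real R (event G)).
  split; last exact: sparse_real_irrational.
  by rewrite sparse_real_gt0 // sparse_real_lt1.
exists (sparse_real R (event G)); split=> //.
  split=> //; apply: closedC.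
  exact: primrec_gen_sum_below_1sparse (primrec_event hG).
move=> [_ /PR_given hup].
(* The successor skips the default entry at index 0, so that argument [n] corresponds to the event
   time [t n]. *)
pose f (x : 1.-tuple nat) :=
  rat_code (gen_sum_below (sparse_real R (event G)) 2 (thead x).+1).
have /closedC /hU [i [_ hi]] : primrec_in C f.
  pose w (x : 1.-tuple nat) : 2.-tuple nat := [tuple 2; (thead x).+1]%N.
  apply: (primrec_ext (g := fun x => fun2 _ (w x))); last first.
    apply: (primrec_subst hup).
    apply: (primrec_tuple_cons (w := fun x => [tuple (thead x).+1])); first by solve_primrec.
    apply: (primrec_tuple_cons (w := fun x => [tuple])); last by case.
    by apply: primrec_succ; exact: (primrec_thead (w := id) (@primrec_tuple_id C _)).
  by move=> x; rewrite /fun2 /f /w !(tnth_nth 0%N).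
have := hi [tuple i]; rewrite /f theadE (gen_sum_below_sparse2 R tS et te) /=.
rewrite -[X in rat_code X]mul1r -[1]/(1%:R) rat_code_frac ?expn_gt0 //.
rewrite muln1 => ei; have := tf i; rewrite /fun2 !(tnth_nth 0%N) /= -ei.
apply/negP; rewrite -leqNgt /frac_code gcd1n !divn1.
have lt4 : (t i < 2 ^ (4 ^ t i))%N.
  by apply: (@ltn_trans (4 ^ t i)); exact: ltn_expl.
have := ltn_expl (2 * 2 ^ (4 ^ t i)) (isT : 1 < 2)%N.
set z := (2 ^ (2 * _))%N; lia.
Qed.

Theorem theorem6 (R : realType) (C : fun_class)
    (hC : subrecursive_class C) (hPR : closed_under_primrec C) :
  exists alpha beta : R,
    [/\ irr01 alpha, irr01 beta,
        (class_gdown C `\` class_gup C) alpha &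
        (class_gup C `\` class_gdown C) beta].
Proof.
have [x [ix dx ux]] := sparse_separation R hC hPR.
have ix' := irr01_1B ix.
(* Sums from above of [x] are by definition sums from below of [1 - x], and reflecting twice returns
   [x], so [1 - x] exchanges the two classes. *)
exists x, (1 - x); split=> //; split=> //.
  by case: dx => _; split.
move=> [_ h]; apply: ux; split=> //.
by move: h; rewrite /gen_sum_above /sum_approx_above subKr.
Qed.
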